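(* Let $E/\mathbb{Q}$ be an elliptic curve. Then: (i) if $E$ has good reduction at $2$, then $\operatorname{rmm}(E)=R_i$ with $i\in\{2,4,6,7,8,9,10,11,12\}$; if $E$ has good reduction at $3$, then $\operatorname{rmm}(E)=R_i$ with $i\in\{1,\dots,12\}$; (ii) if $E$ has multiplicative reduction at $2$, then $\operatorname{rmm}(E)=R_i$ with $i\in\{7,8,9,10,11,12\}$; if $E$ has multiplicative reduction at $3$, then $\operatorname{rmm}(E)=R_i$ with $i\in\{3,4,5,6,7,8,11,12\}$; (iii) if $E$ has additive reduction at $2$, then $\operatorname{rmm}(E)=R_i$ with $i\in\{1,3,5\}$; if $E$ has additive reduction at $3$, then $\operatorname{rmm}(E)=R_i$ with $i\in\{1,2,9,10\}$.
   Context: For a Weierstrass model $y^2+a_1xy+a_3y=x^3+a_2x^2+a_4x+a_6$ set $c_4=a_1^4+8a_1^2a_2-24a_1a_3+16a_2^2-48a_4$, $c_6=-(a_1^2+4a_2)^3+36(a_1^2+4a_2)(2a_4+a_1a_3)-216(a_3^2+4a_6)$, $\Delta=(c_4^3-c_6^2)/1728$. A global minimal model of $E/\mathbb{Q}$ is an integral Weierstrass model $\mathbb{Q}$-isomorphic to $E$ whose discriminant has minimal absolute value; let $c_4,c_6,\Delta$ be its invariants. For a prime $p$, $E$ has good reduction at $p$ if $p\nmid\Delta$, multiplicative reduction at $p$ if $p\mid\Delta$ and $p\nmid c_4$, and additive reduction at $p$ if $p\mid\gcd(c_4,\Delta)$. The reduced minimal model of $E$ is the unique global minimal model with $a_1,a_3\in\{0,1\}$,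 $a_2\in\{-1,0,1\}$, and $\operatorname{rmm}(E)=(a_1,a_2,a_3)$ for it. $R_1=(0,0,0)$, $R_2=(0,0,1)$, $R_3=(0,-1,0)$, $R_4=(0,-1,1)$, $R_5=(0,1,0)$, $R_6=(0,1,1)$, $R_7=(1,0,0)$, $R_8=(1,0,1)$, $R_9=(1,-1,0)$, $R_{10}=(1,-1,1)$, $R_{11}=(1,1,0)$, $R_{12}=(1,1,1)$. *)

(* Defs.v *)
From HB Require Import structures.
From mathcomp Require Import all_boot all_order all_algebra.
From mathcomp Require Import boolp.
From mathcomp Require Import zify ring lra.
Set Implicit Arguments.
Unset Strict Implicit.
Unset Printing Implicit Defensive.
Import Order.TTheory GRing.Theory Num.Theory.
Local Open Scope ring_scope.

(* y^2 + a1 x y + a3 y = x^3 + a2 x^2 + a4 x + a6 *)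
Record weierstrass (R : Type) := Weierstrass { a1 : R; a2 : R; a3 : R; a4 : R; a6 : R }.

Definition c4 (R : comNzRingType) (W : weierstrass R) : R :=
  a1 W ^+ 4 + 8 * a1 W ^+ 2 * a2 W - 24 * a1 W * a3 W + 16 * a2 W ^+ 2 - 48 * a4 W.

Definition c6 (R : comNzRingType) (W : weierstrass R) : R :=
  - (a1 W ^+ 2 + 4 * a2 W) ^+ 3
  + 36 * (a1 W ^+ 2 + 4 * a2 W) * (2 * a4 W + a1 W * a3 W)
  - 216 * (a3 W ^+ 2 + 4 * a6 W).

Definition disc (W : weierstrass rat) : rat := (c4 W ^+ 3 - c6 W ^+ 2) / 1728.

(* The division is exact: see discZ_exact and disc_rat_model below. *)
Definition discZ (M : weierstrass int) : int := ((c4 M ^+ 3 - c6 M ^+ 2) %/ 1728)%Z.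

Record elliptic_curve := EllipticCurve {
  ec_model :> weierstrass rat;
  ec_nonsingular : disc ec_model != 0
}.

(* The model obtained from W by substituting x := u^2 x + r and
   y := u^3 y + u^2 s x + t and dividing by u^6: see weq_change below. *)
Definition change (u r s t : rat) (W : weierstrass rat) : weierstrass rat :=
  {| a1 := (a1 W + 2 * s) / u;
     a2 := (a2 W - s * a1 W + 3 * r - s ^+ 2) / u ^+ 2;
     a3 := (a3 W + r * a1 W + 2 * t) / u ^+ 3;
     a4 := (a4 W - s * a3 W + 2 * r * a2 W - (t + r * s) * a1 W
            + 3 * r ^+ 2 - 2 * s * t) / u ^+ 4;
     a6 := (a6 W + r * a4 W + r ^+ 2 * a2 W + r ^+ 3 - t * a3 W
            - t ^+ 2 - r * t * a1 W) / u ^+ 6 |}.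

Definition isomorphic (W W' : weierstrass rat) : Prop :=
  exists u r s t : rat, u != 0 /\ W' = change u r s t W.

Definition rat_model (M : weierstrass int) : weierstrass rat :=
  {| a1 := (a1 M)%:~R; a2 := (a2 M)%:~R; a3 := (a3 M)%:~R;
     a4 := (a4 M)%:~R; a6 := (a6 M)%:~R |}.

Definition global_minimal_model (E : elliptic_curve) (M : weierstrass int) : Prop :=
  isomorphic E (rat_model M) /\
  forall N : weierstrass int, isomorphic E (rat_model N) -> `|discZ M| <= `|discZ N|.

(* All global minimal models of E have the same c4, c6 and discriminant
   (global_minimal_model_invariants below), so that the existential quantifiers
   may equivalently be replaced by universal ones. *)
Definition good_reduction (E : elliptic_curve) (p : nat) : Prop :=
  exists2 M, global_minimal_model E M & ~~ (p%:Z %| discZ M)%Z.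

Definition multiplicative_reduction (E : elliptic_curve) (p : nat) : Prop :=
  exists2 M, global_minimal_model E M &
    (p%:Z %| discZ M)%Z /\ ~~ (p%:Z %| c4 M)%Z.

Definition additive_reduction (E : elliptic_curve) (p : nat) : Prop :=
  exists2 M, global_minimal_model E M & (p%:Z %| gcdz (c4 M) (discZ M))%Z.

Definition is_reduced_minimal_model (E : elliptic_curve) (M : weierstrass int) : Prop :=
  global_minimal_model E M /\
  [/\ a1 M \in [:: 0; 1], a3 M \in [:: 0; 1] & a2 M \in [:: -1; 0; 1]].

Definition weq (W : weierstrass rat) (x y : rat) : rat :=
  y ^+ 2 + a1 W * x * y + a3 W * y - (x ^+ 3 + a2 W * x ^+ 2 + a4 W * x + a6 W).

Lemma weq_change u r s t W x y : u != 0 ->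
  weq W (u ^+ 2 * x + r) (u ^+ 3 * y + u ^+ 2 * s * x + t)
  = u ^+ 6 * weq (change u r s t W) x y.
Proof. by move=> u0; rewrite /weq /=; field. Qed.

Lemma weierstrass_eq (R : Type) (W W' : weierstrass R) :
  a1 W = a1 W' -> a2 W = a2 W' -> a3 W = a3 W' -> a4 W = a4 W' -> a6 W = a6 W' -> W = W'.
Proof. by case: W W' => [????? []] /= ????? -> -> -> -> ->. Qed.

Lemma c4_change u r s t W : u != 0 -> c4 (change u r s t W) = c4 W / u ^+ 4.
Proof. by move=> u0; rewrite /c4 /=; field. Qed.

Lemma c6_change u r s t W : u != 0 -> c6 (change u r s t W) = c6 W / u ^+ 6.
Proof. by move=> u0; rewrite /c6 /=; field. Qed.

Lemma disc_change u r s t W : u != 0 -> disc (change u r s t W) = disc W / u ^+ 12.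
Proof.
rewrite /disc; move: 1728^-1 => k u0; rewrite c4_change // c6_change //.
by move: (c4 W) (c6 W) => x y; field.
Qed.

Lemma change_change u r s t u' r' s' t' W : u != 0 -> u' != 0 ->
  change u' r' s' t' (change u r s t W) =
  change (u * u') (r + u ^+ 2 * r') (s + u * s')
         (t + u ^+ 2 * s * r' + u ^+ 3 * t') W.
Proof.
by move=> u0 u0'; apply: weierstrass_eq => /=; field; rewrite ?u0 ?u0'.
Qed.

Lemma isomorphic_trans W1 W2 W3 :
  isomorphic W1 W2 -> isomorphic W2 W3 -> isomorphic W1 W3.
Proof.
move=> [u [r [s [t [u0 ->]]]]] [u' [r' [s' [t' [u0' ->]]]]].
by rewrite change_change //; do 4!eexists; split; last by []; rewrite mulf_neq0.
Qed.

Lemma c4_rat_model M : c4 (rat_model M) = (c4 M)%:~R.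
Proof. by rewrite /c4 /=; ring. Qed.

Lemma c6_rat_model M : c6 (rat_model M) = (c6 M)%:~R.
Proof. by rewrite /c6 /=; ring. Qed.

Lemma discZ_exact M : 1728 * discZ M = c4 M ^+ 3 - c6 M ^+ 2.
Proof.
rewrite /discZ; set b2 := a1 M ^+ 2 + 4 * a2 M; set b4 := 2 * a4 M + a1 M * a3 M.
pose b6 := a3 M ^+ 2 + 4 * a6 M.
pose b8 := a1 M ^+ 2 * a6 M + 4 * a2 M * a6 M - a1 M * a3 M * a4 M
           + a2 M * a3 M ^+ 2 - a4 M ^+ 2.
have -> : c4 M ^+ 3 - c6 M ^+ 2 =
  (- b2 ^+ 2 * b8 - 8 * b4 ^+ 3 - 27 * b6 ^+ 2 + 9 * b2 * b4 * b6) * 1728.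
  by rewrite /c4 /c6 /b2 /b4 /b6 /b8; ring.
by rewrite mulzK // mulrC.
Qed.

Lemma disc_rat_model M : disc (rat_model M) = (discZ M)%:~R.
Proof.
rewrite /disc c4_rat_model c6_rat_model -!rmorphXn -rmorphB /= -discZ_exact.
have k0 : (1728 : rat) != 0 by rewrite pnatr_eq0.
by rewrite rmorphM rmorph_nat; move: (1728 : rat) k0 => k k0; rewrite mulrAC divff ?mul1r.
Qed.

Lemma eq_norm_div (a x y : rat) :
  a != 0 -> 0 <= x -> 0 <= y -> `|a / x| = `|a / y| -> x = y.
Proof.
move=> a0 x0 y0; rewrite (normrM a x^-1) (normrM a y^-1).
have na0 : `|a| != 0 by rewrite normr_eq0.
move/(mulfI na0); rewrite (normfV x) (normfV y) => /invr_inj.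
by rewrite (ger0_norm x0) (ger0_norm y0).
Qed.

Lemma global_minimal_model_invariants E M N :
  global_minimal_model E M -> global_minimal_model E N ->
  [/\ c4 M = c4 N, c6 M = c6 N & discZ M = discZ N].
Proof.
move=> [isoM minM] [isoN minN].
have eqD : `|discZ M| = `|discZ N|.
  by apply/eqP; rewrite eq_le minM // minN.
case: isoM isoN => [u [r [s [t [u0 eM]]]]] [v [r' [s' [t' [v0 eN]]]]].
have D0 := ec_nonsingular E.
have dM : (discZ M)%:~R = disc E / u ^+ 12 by rewrite -disc_rat_model eM disc_change.
have dN : (discZ N)%:~R = disc E / v ^+ 12 by rewrite -disc_rat_model eN disc_change.
have p12 (w : rat) : w ^+ 12 = (w ^+ 2) ^+ 6 by rewrite -exprM.
have uv12 : u ^+ 12 = v ^+ 12.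
  have : `|(discZ M)%:~R : rat| = `|(discZ N)%:~R| by rewrite -!intr_norm eqD.
  by rewrite dM dN; apply: eq_norm_div => //; rewrite p12 exprn_ge0 // sqr_ge0.
have uv : u ^+ 2 = v ^+ 2.
  apply/eqP; rewrite -(@eqrXn2 _ 6) ?sqr_ge0 //.
  by rewrite -!p12 uv12.
have p4 (w : rat) : w ^+ 4 = (w ^+ 2) ^+ 2 by rewrite -exprM.
have p6 (w : rat) : w ^+ 6 = (w ^+ 2) ^+ 3 by rewrite -exprM.
split; apply: (@intr_inj rat).
- by rewrite -!c4_rat_model eM eN !c4_change // !p4 uv.
- by rewrite -!c6_rat_model eM eN !c6_change // !p6 uv.
- by rewrite dM dN uv12.
Qed.

Lemma reduced_minimal_model_unique E M N :
  is_reduced_minimal_model E M -> is_reduced_minimal_model E N -> M = N.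
Proof.
move=> [gM rM] [gN rN].
have [e4 e6 _] := global_minimal_model_invariants gM gN.
case: M N {gM gN} rM rN e4 e6 => [m1 m2 m3 m4 m6] [n1 n2 n3 n4 n6].
rewrite /c4 /c6 /= !inE => -[hm1 hm3 hm2] [hn1 hn3 hn2].
by case/or3P: hm2 => /eqP ->; case/orP: hm1 => /eqP ->; case/or3P: hn2 => /eqP ->;
  case/orP: hn1 => /eqP -> e4 e6; try (exfalso; lia);
  case/orP: hm3 e4 e6 => /eqP ->; case/orP: hn3 => /eqP -> e4 e6;
  try (exfalso; lia); apply: weierstrass_eq => /=; lia.
Qed.

Lemma integral_model_exists (E : elliptic_curve) :
  exists M, isomorphic E (rat_model M).
Proof.
pose d := (denq (a1 E) * denq (a2 E) * denq (a3 E) * denq (a4 E) * denq (a6 E)).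
have d0 : (d%:~R : rat) != 0 by rewrite intr_eq0 !mulf_neq0 ?denq_neq0.
have scal (q : rat) : exists m : int, q * (denq q)%:~R = m%:~R.
  by exists (numq q); rewrite numqE.
have [m1 e1] := scal (a1 E); have [m2 e2] := scal (a2 E).
have [m3 e3] := scal (a3 E); have [m4 e4] := scal (a4 E).
have [m6 e6] := scal (a6 E).
pose q1 := denq (a1 E); pose q2 := denq (a2 E); pose q3 := denq (a3 E).
pose q4 := denq (a4 E); pose q6 := denq (a6 E).
have dE : (d%:~R : rat) = q1%:~R * q2%:~R * q3%:~R * q4%:~R * q6%:~R by rewrite /d !intrM.
move: d dE d0 => d dE d0.
exists {| a1 := m1 * (q2 * q3 * q4 * q6);
          a2 := m2 * (q1 * q3 * q4 * q6) * d;
          a3 := m3 * (q1 * q2 * q4 * q6) * d ^+ 2;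
          a4 := m4 * (q1 * q2 * q3 * q6) * d ^+ 3;
          a6 := m6 * (q1 * q2 * q3 * q4) * d ^+ 5 |}.
exists (d%:~R)^-1, 0, 0, 0; split; first by rewrite invr_eq0.
by apply: weierstrass_eq; rewrite /= -?exprnP !(intrM, rmorphXn) /= -?e1 -?e2 -?e3 -?e4 -?e6;
  rewrite ?exprVn ?invrK dE; ring.
Qed.

Lemma global_minimal_model_exists (E : elliptic_curve) :
  exists M, global_minimal_model E M.
Proof.
have exP : exists n : nat, `[< exists2 M, isomorphic E (rat_model M) & absz (discZ M) = n >].
  by have [M isoM] := integral_model_exists E; exists (absz (discZ M)); apply/asboolP; exists M.
case: (ex_minnP exP) => n /asboolP [M isoM eM] minn; exists M; split=> // N isoN.
rewrite -!abszE lez_nat eM; apply: minn; apply/asboolP; by exists N.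
Qed.

Lemma reduced_minimal_model_exists (E : elliptic_curve) :
  exists M, is_reduced_minimal_model E M.
Proof.
have [M [isoM minM]] := global_minimal_model_exists E.
have [s hs] : exists s, a1 M + 2 * s \in [:: 0; 1].
  by exists (- (a1 M %/ 2)%Z); rewrite !inE; lia.
have [r hr] : exists r, a2 M - s * a1 M + 3 * r - s ^+ 2 \in [:: -1; 0; 1].
  set k := a2 M - s * a1 M - s ^+ 2.
  exists (- ((k + 1) %/ 3)%Z).
  have -> : a2 M - s * a1 M + 3 * - ((k + 1) %/ 3)%Z - s ^+ 2
            = k - 3 * ((k + 1) %/ 3)%Z by rewrite /k; ring.
  by rewrite !inE; lia.
have [t ht] : exists t, a3 M + r * a1 M + 2 * t \in [:: 0; 1].
  set k := a3 M + r * a1 M.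
  by exists (- (k %/ 2)%Z); rewrite !inE; lia.
pose N := {| a1 := a1 M + 2 * s;
     a2 := a2 M - s * a1 M + 3 * r - s ^+ 2;
     a3 := a3 M + r * a1 M + 2 * t;
     a4 := a4 M - s * a3 M + 2 * r * a2 M - (t + r * s) * a1 M
            + 3 * r ^+ 2 - 2 * s * t;
     a6 := a6 M + r * a4 M + r ^+ 2 * a2 M + r ^+ 3 - t * a3 M
            - t ^+ 2 - r * t * a1 M |}.
have eN : rat_model N = change 1 r%:~R s%:~R t%:~R (rat_model M).
  by apply: weierstrass_eq; rewrite /= ?expr1n divr1; ring.
have dN : discZ N = discZ M.
  apply: (@intr_inj rat); rewrite -!disc_rat_model eN disc_change //.
  by rewrite expr1n divr1.
exists N; split; last by split.
split; last by move=> L isoL; rewrite dN; exact: minM.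
apply: isomorphic_trans isoM _; rewrite eN.
by exists 1, r%:~R, s%:~R, t%:~R.
Qed.

Definition reduced_minimal_model (E : elliptic_curve) : weierstrass int :=
  sval (cid (reduced_minimal_model_exists E)).

Lemma reduced_minimal_modelP E M :
  is_reduced_minimal_model E M <-> M = reduced_minimal_model E.
Proof.
have redE := svalP (cid (reduced_minimal_model_exists E)).
by split=> [redM | ->]; first exact: reduced_minimal_model_unique redM redE.
Qed.

Definition rmm (E : elliptic_curve) : int * int * int :=
  let M := reduced_minimal_model E in (a1 M, a2 M, a3 M).

(* Indexed from 1 to 12; the value at any other index is meaningless. *)
Definition R_ (i : nat) : int * int * int :=
  nth (0, 0, 0)
    [:: (0, 0, 0); (0, 0, 1); (0, -1, 0); (0, -1, 1); (0, 1, 0); (0, 1, 1);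
        (1, 0, 0); (1, 0, 1); (1, -1, 0); (1, -1, 1); (1, 1, 0); (1, 1, 1)] i.-1.

(* Main.v *)
Require Import Defs.
From mathcomp Require Import all_boot all_order all_algebra.
From mathcomp Require Import ring.

(* With b2 = a1^2 + 4 a2 we have c4 = a1 mod 2 and c4 = b2^2 = (a1^2 + a2)^2 mod 3,
   while the discriminant is congruent to a3 mod 2 when a1 = 0.  Hence a1, a2, a3 of
   the reduced minimal model decide the divisibility of c4 by 2 and by 3, and that of
   the discriminant by 2 whenever c4 is even. *)

Import GRing.Theory.
Local Open Scope ring_scope.

(** Each invariant below is a pure power modulo [p], so only its base matters. *)
Lemma prime_dvdz_expDM (p n : nat) (x k : int) :
  prime p -> (0 < n)%N -> (p %| x ^+ n + k * p)%Z = (p %| x)%Z.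
Proof.
move=> p_pr n_gt0; rewrite rpredDr; last exact: dvdz_mull.
by rewrite !dvdzE abszX Euclid_dvdX // n_gt0 andbT.
Qed.

Lemma c4_dvd2 (M : weierstrass int) : (2 %| c4 M)%Z = (2 %| a1 M)%Z.
Proof.
have -> : c4 M = a1 M ^+ 4 + (4 * a1 M ^+ 2 * a2 M - 12 * a1 M * a3 M
                              + 8 * a2 M ^+ 2 - 24 * a4 M) * 2.
  by rewrite /c4; ring.
exact: prime_dvdz_expDM.
Qed.

Lemma c4_dvd3 (M : weierstrass int) :
  (3 %| c4 M)%Z = (3 %| a1 M ^+ 2 + a2 M)%Z.
Proof.
have -> : c4 M = (a1 M ^+ 2 + a2 M) ^+ 2 + (2 * a1 M ^+ 2 * a2 M - 8 * a1 M * a3 M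
                              + 5 * a2 M ^+ 2 - 16 * a4 M) * 3.
  by rewrite /c4; ring.
exact: prime_dvdz_expDM.
Qed.

Lemma discZ_dvd2 (M : weierstrass int) :
  a1 M = 0 -> (2 %| discZ M)%Z = (2 %| a3 M)%Z.
Proof.
move=> a1M.
(* For [a1 M = 0], the only term with an odd coefficient is [-27 * a3 M ^+ 4], split as 1 - 14 *
   2. *)
have -> : discZ M = a3 M ^+ 4
  + (- 8 * a2 M ^+ 2 * (4 * a2 M * a6 M + a2 M * a3 M ^+ 2 - a4 M ^+ 2)
     - 32 * a4 M ^+ 3 - 14 * a3 M ^+ 4 - 108 * a3 M ^+ 2 * a6 M - 216 * a6 M ^+ 2
     + 36 * a2 M * a4 M * (a3 M ^+ 2 + 4 * a6 M)) * 2.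
  apply: (@mulfI _ 1728) => //.
  by rewrite discZ_exact /c4 /c6 a1M; ring.
exact: prime_dvdz_expDM.
Qed.

(** In the numbering, [i <= 6] means a1 = 0, and then odd [i] means a3 = 0; the indices 1, 2, 9, 10
    are those with (a1, a2) = (0, 0) or (1, -1), where 3 divides a1^2 + a2. *)
Lemma rmm_index (E : elliptic_curve) (M : weierstrass int) :
  global_minimal_model E M ->
  exists i : nat,
  [/\ i \in iota 1 12, rmm E = R_ i, (2 %| c4 M)%Z = (i <= 6)%N,
      (i <= 6)%N -> (2 %| discZ M)%Z = odd i
    & (3 %| c4 M)%Z = (i \in [:: 1; 2; 9; 10]%N)].
Proof.
move=> minM; rewrite /rmm.
have [minN] := (reduced_minimal_modelP E (reduced_minimal_model E)).2 erefl.
have [-> _ ->] := global_minimal_model_invariants minM minN.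
set N := reduced_minimal_model E => -[].
rewrite c4_dvd2 c4_dvd3 !inE.
have := @discZ_dvd2 N.
by move=> D /orP[]/eqP A1 /orP[]/eqP A3 /or3P[]/eqP A2; move: D; rewrite A1 A2 A3 => D;
  (* The cases run over a1, then a3, then a2 = -1, 0, 1. *)
  [exists 3%N|exists 1%N|exists 5%N|exists 4%N|exists 2%N|exists 6%N
  |exists 9%N|exists 7%N|exists 11%N|exists 10%N|exists 8%N|exists 12%N];
  split=> // _; rewrite D.
Qed.

Local Close Scope ring_scope.

Theorem theoremB (E : elliptic_curve) :
  ((good_reduction E 2 ->
      exists2 i : nat, i \in [:: 2; 4; 6; 7; 8; 9; 10; 11; 12] & rmm E = R_ i) /\
   (good_reduction E 3 ->
      exists2 i : nat, i \in [:: 1; 2; 3; 4; 5; 6; 7; 8; 9; 10; 11; 12] & rmm E = R_ i)) /\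
  ((multiplicative_reduction E 2 ->
      exists2 i : nat, i \in [:: 7; 8; 9; 10; 11; 12] & rmm E = R_ i) /\
   (multiplicative_reduction E 3 ->
      exists2 i : nat, i \in [:: 3; 4; 5; 6; 7; 8; 11; 12] & rmm E = R_ i)) /\
  ((additive_reduction E 2 ->
      exists2 i : nat, i \in [:: 1; 3; 5] & rmm E = R_ i) /\
   (additive_reduction E 3 ->
      exists2 i : nat, i \in [:: 1; 2; 9; 10] & rmm E = R_ i)).
Proof.
(* Each of the six claims becomes a finite check over the twelve indices. *)
have ind M (minM : global_minimal_model E M) (s : seq nat) :
    {in iota 1 12, forall i, (2 %| c4 M)%Z = (i <= 6)%N ->
       ((i <= 6)%N -> (2 %| discZ M)%Z = odd i) ->
       (3 %| c4 M)%Z = (i \in [:: 1; 2; 9; 10]%N) -> i \in s} ->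
    exists2 i : nat, i \in s & rmm E = R_ i.
  have [i [iI Ei c2 d2 c3]] := rmm_index _ _ minM.
  by move=> sP; exists i => //; apply: sP.
split; [|split]; split=> -[M minM]; rewrite ?dvdz_gcd => red; apply: ind minM _ _;
  move=> i; rewrite !inE => iI c2 d2 c3.
all: repeat (case/orP: iI => [/eqP iE|iI]); [..|move/eqP: iI => iE]; subst i => //.
(* The remaining indices lie outside the claimed list and contradict the reduction type. *)
all: by move: red; rewrite ?c2 ?c3; try rewrite (d2 isT); first [done | case].
Qed.
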